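(* Let $q\in\mathbb{C}$ and let $(\mathcal{S}(q),[\cdot,\cdot])$ be the Block Lie superalgebra. If $q\ne 0$, then all the transposed Poisson superalgebra structures on $(\mathcal{S}(q),[\cdot,\cdot])$ are trivial. If $q=0$, then the non-trivial transposed Poisson superalgebra structures on $(\mathcal{S}(0),[\cdot,\cdot])$ are, up to an isomorphism, of one of the following two forms (where all products of basis elements not listed are zero): $$\text{(1)}\quad L_{0,0}\cdot L_{0,0}=L_{0,0},\qquad L_{0,0}\cdot G_{0,0}=G_{0,0}\cdot L_{0,0}=G_{0,0};$$ $$\text{(2)}\quad L_{0,0}\cdot L_{0,0}=L_{0,0}.$$
   Context: All algebras are over $\mathbb{C}$ and all linear maps are $\mathbb{C}$-linear. For $q\in\mathbb{C}$, the Block Lie superalgebra $\mathcal{S}(q)=\mathcal{S}(q)_0\oplus\mathcal{S}(q)_1$ is the complex Lie superalgebra whose even part $\mathcal{S}(q)_0$ has basis $\{L_{m,i}\mid m,i\in\mathbb{Z}\}$, whose odd part $\mathcal{S}(q)_1$ has basis $\{G_{m,i}\mid m,i\in\mathbb{Z}\}$, with brackets $[L_{m,i},L_{n,j}]=(n(i+q)-m(j+q))L_{m+n,i+j}$, $[L_{m,i},G_{n,j}]=\left(n(i+q)-m\left(j+\frac q2\right)\right)G_{m+n,i+j}$, $[G_{m,i},G_{n,j}]=2qL_{m+n,i+j}$ for all $m,n,i,j\in\mathbb{Z}$ (and $[G_{n,j},L_{m,i}]=-[L_{m,i},G_{n,j}]$). A transposed Poisson superalgebra structure on a Lie superalgebra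 $(\mathfrak{L}=\mathfrak{L}_0\oplus\mathfrak{L}_1,[\cdot,\cdot])$ is a bilinear multiplication $\cdot$ on $\mathfrak{L}$ making $(\mathfrak{L},\cdot)$ a supercommutative associative superalgebra with respect to the given $\mathbb{Z}_2$-grading (so $\mathfrak{L}_a\cdot\mathfrak{L}_b\subseteq\mathfrak{L}_{a+b}$ and $x\cdot y=(-1)^{|x||y|}y\cdot x$ for homogeneous $x,y$) and satisfying $2z\cdot[x,y]=[z\cdot x,y]+(-1)^{|x||z|}[x,z\cdot y]$ for all $x,y,z\in\mathfrak{L}_0\cup\mathfrak{L}_1$. It is called trivial if $x\cdot y=0$ for all $x,y$. Two such structures $\cdot$ and $*$ on $(\mathfrak{L},[\cdot,\cdot])$ are isomorphic if there is an automorphism $\phi$ of $(\mathfrak{L},[\cdot,\cdot])$ with $\phi(x\cdot y)=\phi(x)*\phi(y)$ for all $x,y\in\mathfrak{L}$. *)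

(* Defs.v *)
From HB Require Import structures.
From mathcomp Require Import all_boot all_order all_algebra.
From mathcomp Require Import finmap reals complex ring.
From mathcomp Require Import monalg.

Set Implicit Arguments.
Unset Strict Implicit.
Unset Printing Implicit Defensive.

Import GRing.Theory.

Local Open Scope ring_scope.

(* The parities 0 and 1 are [false] and [true]: addition mod 2 is [(+)], the
   product |x||y| is [&&], and [lsa_hom a] is the homogeneous component of
   parity [a] (which contains 0).  The axioms are the usual ones when 2 and 3 are
   invertible in F. *)
Record lieSuperalgebra (F : fieldType) := LieSuperalgebra {
  lsa_sort :> lmodType F;
  lsa_hom : bool -> lsa_sort -> Prop;
  lsa_br : lsa_sort -> lsa_sort -> lsa_sort;
  lsa_hom0 : forall a, lsa_hom a 0;
  lsa_homD : forall a c x y, lsa_hom a x -> lsa_hom a y -> lsa_hom a (c *: x + y);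
  lsa_hom_inj : forall x, lsa_hom false x -> lsa_hom true x -> x = 0;
  lsa_hom_decomp : forall x, exists x0 x1,
    [/\ lsa_hom false x0, lsa_hom true x1 & x = x0 + x1];
  lsa_br_bilinear : bilinear_for *:%R *:%R lsa_br;
  lsa_br_hom : forall a b x y, lsa_hom a x -> lsa_hom b y ->
        lsa_hom (a (+) b) (lsa_br x y);
  lsa_br_skew : forall a b x y, lsa_hom a x -> lsa_hom b y ->
        lsa_br x y = - ((-1) ^+ (a && b) *: lsa_br y x);
  lsa_br_jacobi : forall a b c x y z, lsa_hom a x -> lsa_hom b y -> lsa_hom c z ->
        lsa_br x (lsa_br y z) =
        lsa_br (lsa_br x y) z + (-1) ^+ (a && b) *: lsa_br y (lsa_br x z)
}.

Record transposed_poisson (F : fieldType) (g : lieSuperalgebra F)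
    (mul : g -> g -> g) : Prop := TransposedPoisson {
  tp_bilinear : bilinear_for *:%R *:%R mul;
  tp_graded : forall a b x y,
    lsa_hom a x -> lsa_hom b y -> lsa_hom (a (+) b) (mul x y);
  tp_supercomm : forall a b x y, lsa_hom a x -> lsa_hom b y ->
    mul x y = (-1) ^+ (a && b) *: mul y x;
  tp_assoc : associative mul;
  tp_leibniz : forall a b c x y z, lsa_hom a x -> lsa_hom b y -> lsa_hom c z ->
    2%:R *: mul z (lsa_br x y) =
    lsa_br (mul z x) y + (-1) ^+ (a && c) *: lsa_br x (mul z y)
}.

Definition tp_trivial (F : fieldType) (g : lieSuperalgebra F)
    (mul : g -> g -> g) : Prop :=
  forall x y, mul x y = 0.

Record lsa_automorphism (F : fieldType) (g : lieSuperalgebra F)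
    (phi : g -> g) : Prop := LsaAutomorphism {
  aut_linear : linear phi;
  aut_bijective : bijective phi;
  aut_hom : forall a x, lsa_hom a x -> lsa_hom a (phi x);
  aut_br : forall x y, phi (lsa_br x y) = lsa_br (phi x) (phi y)
}.

Definition tp_isomorphic (F : fieldType) (g : lieSuperalgebra F)
    (mul mul' : g -> g -> g) : Prop :=
  exists phi : g -> g, lsa_automorphism phi /\
    forall x y, phi (mul x y) = mul' (phi x) (phi y).

Section BilinearExtension.
Variables (F : fieldType) (K : choiceType).
Local Notation V := {malg F[K]}.

(* The bilinear map on the free module with basis [K] given on the basis by
   [t]. *)
Definition bilin_ext (t : K -> K -> V) (x y : V) : V :=
  \sum_(k <- msupp x) \sum_(l <- msupp y) (x@_k * y@_l) *: t k l.

Lemma bilin_extwl t (x y : V) (d : {fset K}) : (msupp x `<=` d)%fset ->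
  bilin_ext t x y = \sum_(k <- d) \sum_(l <- msupp y) (x@_k * y@_l) *: t k l.
Proof.
move=> sd; rewrite /bilin_ext (big_fset_incl _ sd) // => k kd kx.
by rewrite big1 // => l _; rewrite mcoeff_outdom // mul0r scale0r.
Qed.

Lemma bilin_extw t (x y : V) (d e : {fset K}) :
  (msupp x `<=` d)%fset -> (msupp y `<=` e)%fset ->
  bilin_ext t x y = \sum_(k <- d) \sum_(l <- e) (x@_k * y@_l) *: t k l.
Proof.
move=> sd se; rewrite (bilin_extwl _ _ sd); apply: eq_bigr => k _.
rewrite (big_fset_incl _ se) // => l le ly.
by rewrite (@mcoeff_outdom _ _ y) // mulr0 scale0r.
Qed.

Lemma bilin_ext_bilinear t : bilinear_for *:%R *:%R (bilin_ext t).
Proof.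
split=> [y c x z|x c y z] /=.
- pose e := (msupp (c *: x + z) `|` (msupp x `|` msupp z))%fset.
  rewrite (@bilin_extw t (c *: x + z) y e (msupp y)) ?fsubsetUl //.
  rewrite (@bilin_extw t x y e (msupp y)) //; last first.
    by rewrite fsubsetU // fsubsetUl orbT.
  rewrite (@bilin_extw t z y e (msupp y)) //; last first.
    by rewrite fsubsetU // fsubsetUr orbT.
  rewrite scaler_sumr -big_split /=; apply: eq_bigr => k _.
  rewrite scaler_sumr -big_split /=; apply: eq_bigr => l _.
  by rewrite mcoeffD mcoeffZ scalerA -scalerDl; congr (_ *: _); ring.
- pose e := (msupp (c *: y + z) `|` (msupp y `|` msupp z))%fset.
  rewrite (@bilin_extw t x (c *: y + z) (msupp x) e) ?fsubsetUl //.
  rewrite (@bilin_extw t x y (msupp x) e) //; last first.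
    by rewrite fsubsetU // fsubsetUl orbT.
  rewrite (@bilin_extw t x z (msupp x) e) //; last first.
    by rewrite fsubsetU // fsubsetUr orbT.
  rewrite scaler_sumr -big_split /=; apply: eq_bigr => k _.
  rewrite scaler_sumr -big_split /=; apply: eq_bigr => l _.
  by rewrite mcoeffD mcoeffZ scalerA -scalerDl; congr (_ *: _); ring.
Qed.

Lemma bilin_extU t k l : bilin_ext t << k >> << l >> = t k l.
Proof.
rewrite /bilin_ext !msuppU oner_eq0 !big_seq_fset1 !mcoeffUU.
by rewrite mulr1 scale1r.
Qed.

End BilinearExtension.

(* The identities on generators are proved over an arbitrary module, where
   unification cannot unfold the basis vectors of the free module. *)
Lemma block_skew_gen (F : fieldType) (V : lmodType F) (q h : F)
    (L G : int -> int -> V) (br : V -> V -> V) :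
  (forall m i n j, br (L m i) (L n j) =
    (n%:~R * (i%:~R + q) - m%:~R * (j%:~R + q)) *: L (m + n) (i + j)) ->
  (forall m i n j, br (L m i) (G n j) =
    (n%:~R * (i%:~R + q) - m%:~R * (j%:~R + h)) *: G (m + n) (i + j)) ->
  (forall m i n j, br (G n j) (L m i) =
    (m%:~R * (j%:~R + h) - n%:~R * (i%:~R + q)) *: G (m + n) (i + j)) ->
  (forall m i n j, br (G m i) (G n j) = (2%:R * q) *: L (m + n) (i + j)) ->
  forall (a b : bool) m i n j,
  let X d := if d then G else L in
  br (X a m i) (X b n j) = - ((-1) ^+ (a && b) *: br (X b n j) (X a m i)).
Proof.
move=> LL LG GL GG a b m i n j /=.
case: a b => [] []; rewrite ?expr1 ?expr0 ?(LL, LG, GL, GG) ?scale1r ?scaleN1r.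
- by rewrite opprK [m + n]addrC [i + j]addrC.
- by rewrite -scaleNr opprB.
- by rewrite -scaleNr opprB.
- by rewrite -scaleNr opprB [m + n]addrC [i + j]addrC.
Qed.

Lemma block_jacobi_gen (F : fieldType) (V : lmodType F) (q h : F)
    (L G : int -> int -> V) (br : V -> V -> V) :
  h + h = q ->
  (forall c x y, br (c *: x) y = c *: br x y) ->
  (forall c x y, br x (c *: y) = c *: br x y) ->
  (forall m i n j, br (L m i) (L n j) =
    (n%:~R * (i%:~R + q) - m%:~R * (j%:~R + q)) *: L (m + n) (i + j)) ->
  (forall m i n j, br (L m i) (G n j) =
    (n%:~R * (i%:~R + q) - m%:~R * (j%:~R + h)) *: G (m + n) (i + j)) ->
  (forall m i n j, br (G n j) (L m i) =
    (m%:~R * (j%:~R + h) - n%:~R * (i%:~R + q)) *: G (m + n) (i + j)) ->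
  (forall m i n j, br (G m i) (G n j) = (2%:R * q) *: L (m + n) (i + j)) ->
  forall (a b c : bool) m i n j r s,
  let X d := if d then G else L in
  br (X a m i) (br (X b n j) (X c r s)) =
  br (br (X a m i) (X b n j)) (X c r s) +
  (-1) ^+ (a && b) *: br (X b n j) (br (X a m i) (X c r s)).
Proof.
move=> hq Zl Zr LL LG GL GG a b c m i n j r s /=.
have E (f : int -> int -> V) u u1 u2 v v1 v2 (k k1 k2 : F) :
    u = u1 -> u = u2 -> v = v1 -> v = v2 -> k = k1 + k2 ->
    k *: f u v = k1 *: f u1 v1 + k2 *: f u2 v2.
  by move=> <- <- <- <- ->; rewrite scalerDl.
case: a b c => [] [] []; rewrite ?expr1 ?expr0.
all: rewrite ?(LL, LG, GL, GG) ?(Zl, Zr) ?(LL, LG, GL, GG) ?scalerA -?hq.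
all: apply: E; [ring | ring | ring | ring | rewrite !rmorphD /=; ring].
Qed.

Section Block.
Variables (F : fieldType) (q : F).

(* [(false, (m, i))] is the index of L_{m,i} and [(true, (m, i))] that of
   G_{m,i}. *)
Definition block_index := (bool * (int * int))%type.

Definition block_space := {malg F[block_index]}.
Definition block_L (m i : int) : block_space := << (false, (m, i)) >>.
Definition block_G (m i : int) : block_space := << (true, (m, i)) >>.

Definition block_hom (a : bool) (x : block_space) : Prop :=
  forall k, k \in msupp x -> k.1 = a.

Definition block_LG_coef (m i n j : int) : F :=
  n%:~R * (i%:~R + q) - m%:~R * (j%:~R + q / 2%:R).

Definition block_br_basis (k l : block_index) : block_space :=
  match k, l with
  | (false, (m, i)), (false, (n, j)) =>
      (n%:~R * (i%:~R + q) - m%:~R * (j%:~R + q)) *: block_L (m + n) (i + j)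
  | (false, (m, i)), (true, (n, j)) =>
      block_LG_coef m i n j *: block_G (m + n) (i + j)
  | (true, (n, j)), (false, (m, i)) =>
      - (block_LG_coef m i n j *: block_G (m + n) (i + j))
  | (true, (m, i)), (true, (n, j)) =>
      (2%:R * q) *: block_L (m + n) (i + j)
  end.

Definition block_br : block_space -> block_space -> block_space :=
  bilin_ext block_br_basis.

Fact block_hom0 a : block_hom a 0.
Proof. by move=> k; rewrite msupp0. Qed.

Fact block_homD a c x y :
  block_hom a x -> block_hom a y -> block_hom a (c *: x + y).
Proof.
move=> hx hy k; rewrite -mcoeff_neq0 mcoeffD mcoeffZ => nz.
have [/hx//|kx] := boolP (k \in msupp x).
apply: hy; rewrite -mcoeff_neq0; move: nz.
by rewrite (mcoeff_outdom kx) mulr0 add0r.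
Qed.

Lemma block_homU k : block_hom k.1 << k >>.
Proof. by move=> l; rewrite msuppU oner_eq0 inE => /eqP ->. Qed.

Lemma block_homL m i : block_hom false (block_L m i).
Proof. exact: block_homU. Qed.

Lemma block_homG m i : block_hom true (block_G m i).
Proof. exact: block_homU. Qed.

Lemma block_hom_ind a (P : block_space -> Prop) :
  P 0 -> (forall c x y, P x -> P y -> P (c *: x + y)) ->
  (forall m i, P ((if a then block_G else block_L) m i)) ->
  forall x, block_hom a x -> P x.
Proof.
move=> P0 PD PU x hx.
have {}PU k : k.1 = a -> P << k >> 
  by case: k => b [m i] /= ->; have := PU m i; case: (a).
rewrite [x]monalgE.
rewrite big_seq; elim/big_rec: _ => // k y kx Py.
have -> : << x@_k *g k >> = x@_k *: << k >> :> block_space.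
  by apply/malgP => l; rewrite mcoeffZ !mcoeffU mulr_natr.
by apply: PD => //; apply/PU/hx.
Qed.

Fact block_hom_inj x : block_hom false x -> block_hom true x -> x = 0.
Proof.
move=> h0 h1; apply/malgP => k; rewrite mcoeff0; apply/eqP.
by rewrite mcoeff_eq0; apply/negP => kx; move: (h0 _ kx); rewrite (h1 _ kx).
Qed.

Fact block_hom_decomp x : exists x0 x1,
  [/\ block_hom false x0, block_hom true x1 & x = x0 + x1].
Proof.
exists (\sum_(k <- msupp x | k.1 == false) << x@_k *g k >>).
exists (\sum_(k <- msupp x | k.1 == true) << x@_k *g k >>).
have S b : block_hom b (\sum_(k <- msupp x | k.1 == b) << x@_k *g k >>).
  elim/big_rec: _ => [|k y /eqP kb hy]; first exact: block_hom0.
  rewrite -[<< _ *g _ >>]scale1r; apply: block_homD => // l.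
  by move/(fsubsetP msuppU_le); rewrite inE => /eqP ->.
split; [exact: S | exact: S | rewrite [LHS]monalgE].
rewrite (bigID (fun k : block_index => k.1 == true)) /= addrC; congr (_ + _).
by apply: eq_bigl => k; case: (k.1).
Qed.

Fact block_br_bilinear : bilinear_for *:%R *:%R block_br.
Proof. exact: bilin_ext_bilinear. Qed.

Lemma block_brDl c x y z :
  block_br (c *: x + y) z = c *: block_br x z + block_br y z.
Proof. exact: block_br_bilinear.1. Qed.

Lemma block_brDr c x y z :
  block_br z (c *: x + y) = c *: block_br z x + block_br z y.
Proof. exact: block_br_bilinear.2. Qed.

Lemma block_br0l x : block_br 0 x = 0.
Proof. by have := block_brDl (-1) 0 0 x; rewrite scaler0 addr0 scaleN1r addNr. Qed.

Lemma block_br0r x : block_br x 0 = 0.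
Proof. by have := block_brDr (-1) 0 0 x; rewrite scaler0 addr0 scaleN1r addNr. Qed.

Lemma block_brZl c x y : block_br (c *: x) y = c *: block_br x y.
Proof. by have := block_brDl c x 0 y; rewrite block_br0l !addr0. Qed.

Lemma block_brZr c x y : block_br x (c *: y) = c *: block_br x y.
Proof. by have := block_brDr c y 0 x; rewrite block_br0r !addr0. Qed.

Lemma block_brNl x y : block_br (- x) y = - block_br x y.
Proof. by rewrite -scaleN1r block_brZl scaleN1r. Qed.

Lemma block_brNr x y : block_br x (- y) = - block_br x y.
Proof. by rewrite -scaleN1r block_brZr scaleN1r. Qed.

Lemma block_brU k l : block_br << k >> << l >> = block_br_basis k l.
Proof. exact: bilin_extU. Qed.

Lemma block_brLL m i n j : block_br (block_L m i) (block_L n j) =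
  (n%:~R * (i%:~R + q) - m%:~R * (j%:~R + q)) *: block_L (m + n) (i + j).
Proof. exact: block_brU. Qed.

Lemma block_brLG m i n j : block_br (block_L m i) (block_G n j) =
  (n%:~R * (i%:~R + q) - m%:~R * (j%:~R + q / 2%:R)) *: block_G (m + n) (i + j).
Proof. exact: block_brU. Qed.

Lemma block_brGL m i n j : block_br (block_G n j) (block_L m i) =
  - block_br (block_L m i) (block_G n j).
Proof. by rewrite [LHS]block_brU [X in - X]block_brU. Qed.

Lemma block_brGG m i n j : block_br (block_G m i) (block_G n j) =
  (2%:R * q) *: block_L (m + n) (i + j).
Proof. exact: block_brU. Qed.

Lemma block_brGL' m i n j : block_br (block_G n j) (block_L m i) =
  (m%:~R * (j%:~R + q / 2%:R) - n%:~R * (i%:~R + q)) *: block_G (m + n) (i + j).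
Proof. by rewrite block_brGL block_brLG -scaleNr opprB. Qed.

Fact block_br_hom a b x y :
  block_hom a x -> block_hom b y -> block_hom (a (+) b) (block_br x y).
Proof.
move=> hx hy; move: x hx.
apply: block_hom_ind => [|c x x' hx hx'|m i].
- by rewrite block_br0l; apply: block_hom0.
- by rewrite block_brDl; apply: block_homD.
move: y hy; apply: block_hom_ind => [|c y y' hy hy'|n j].
- by rewrite block_br0r; apply: block_hom0.
- by rewrite block_brDr; apply: block_homD.
case: a b => [] [] /=.
- rewrite block_brGG -[_ *: _]addr0; apply: block_homD (block_hom0 _).
  exact: block_homL.
- rewrite block_brGL block_brLG -scaleNr -[_ *: _]addr0.
  by apply: block_homD (block_hom0 _); exact: block_homG.
- rewrite block_brLG -[_ *: _]addr0; apply: block_homD (block_hom0 _).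
  exact: block_homG.
- rewrite block_brLL -[_ *: _]addr0; apply: block_homD (block_hom0 _).
  exact: block_homL.
Qed.

Fact block_br_skew a b x y : block_hom a x -> block_hom b y ->
  block_br x y = - ((-1) ^+ (a && b) *: block_br y x).
Proof.
move=> hx hy; move: x hx.
apply: block_hom_ind => [|c x x' hx hx'|m i].
- by rewrite block_br0l block_br0r scaler0 oppr0.
- by rewrite block_brDl block_brDr hx hx' scalerDr opprD !scalerN !scalerA mulrC.
move: y hy; apply: block_hom_ind => [|c y y' hy hy'|n j].
- by rewrite block_br0l block_br0r scaler0 oppr0.
- by rewrite block_brDl block_brDr hy hy' scalerDr opprD !scalerN !scalerA mulrC.
exact (@block_skew_gen _ _ q (q / 2%:R) block_L block_G block_br
  block_brLL block_brLG block_brGL' block_brGG a b m i n j).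
Qed.

Hypothesis two_neq0 : 2%:R != 0 :> F.

Fact block_br_jacobi a b c x y z :
  block_hom a x -> block_hom b y -> block_hom c z ->
  block_br x (block_br y z) =
  block_br (block_br x y) z + (-1) ^+ (a && b) *: block_br y (block_br x z).
Proof.
move=> hx hy hz; move: x hx.
apply: block_hom_ind => [|d x x' hx hx'|m i].
- by rewrite !block_br0l block_br0r scaler0 addr0.
- rewrite !(block_brDl, block_brDr) hx hx' !scalerDr !scalerA mulrC.
  by rewrite addrACA.
move: y hy; apply: block_hom_ind => [|d y y' hy hy'|n j].
- by rewrite !(block_br0l, block_br0r) scaler0 addr0.
- rewrite !(block_brDl, block_brDr) hy hy' !scalerDr !scalerA mulrC.
  by rewrite addrACA.
move: z hz; apply: block_hom_ind => [|d z z' hz hz'|r s].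
- by rewrite !block_br0r scaler0 addr0.
- rewrite !block_brDr hz hz' !scalerDr !scalerA mulrC.
  by rewrite addrACA.
have hq : q / 2%:R + q / 2%:R = q by field.
exact (@block_jacobi_gen _ _ q (q / 2%:R) block_L block_G block_br hq
  block_brZl block_brZr block_brLL block_brLG block_brGL'
  block_brGG a b c m i n j r s).
Qed.

End Block.

Fact complex_two_neq0 (R : realType) : 2%:R != 0 :> R[i].
Proof. by rewrite Num.Theory.pnatr_eq0. Qed.

Definition block_superalgebra (R : realType) (q : R[i]) :
    lieSuperalgebra R[i] :=
  @LieSuperalgebra _ (block_space R[i]) (@block_hom _) (block_br q)
    (@block_hom0 _) (@block_homD _) (@block_hom_inj _) (@block_hom_decomp _)
    (block_br_bilinear q) (@block_br_hom _ q) (@block_br_skew _ q)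
    (@block_br_jacobi _ q (complex_two_neq0 R)).

Section BlockForms.
Variables (R : realType) (q : R[i]).
Local Notation S := (block_superalgebra q).

Let l00 : block_index := (false, (0, 0)).
Let g00 : block_index := (true, (0, 0)).

Definition block_form1 : S -> S -> S :=
  bilin_ext (fun k l =>
    if (k, l) == (l00, l00) then block_L R[i] 0 0
    else if (k, l) \in [:: (l00, g00); (g00, l00)] then block_G R[i] 0 0
    else 0).

Definition block_form2 : S -> S -> S :=
  bilin_ext (fun k l => if (k, l) == (l00, l00) then block_L R[i] 0 0 else 0).

End BlockForms.

(* Main.v *)
Require Import Defs.
From mathcomp Require Import all_boot all_order all_algebra.
From mathcomp Require Import finmap reals complex ring zify.
From mathcomp Require Import monalg.
From mathcomp Require boolp.

(* For homogeneous z the map x |-> z x is a half-derivation of the Lie bracket.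
   The bracket is graded by Z^2, so the coefficients of z X_b on X_(b + s), for s
   fixed, satisfy a linear functional equation in b.  If q <> 0, the bracket of
   two G's is a non-zero multiple of an L, which makes these coefficients affine
   in b; the equation of the bracket of two L's then leaves only scalar
   multiplications, and L_a L_b = L_b L_a forces L_a to act by 0.  What remains
   are the products of two G's, and the only half-derivation that could give
   one, supported on G_(0,-3q/2), is excluded because G_a G_b is alternating.
   If q = 0, the bracket is (a, b) |-> wedge a b X_(a + b), the half-derivations
   are scalar off the centre <L_(0,0), G_(0,0)>, and commutativity again confines
   the product to the centre: L0 L0 = al L0 and L0 G0 = be G0, where
   associativity gives be^2 = al be.  Rescaling L0, which occurs in no bracket,
   normalises al to 1. *)

Set Implicit Arguments.
Unset Strict Implicit.
Unset Printing Implicit Defensive.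

Import GRing.Theory.

Local Open Scope ring_scope.

(** * Bilinear maps on a free module *)

Section FreeModule.
Variables (F : fieldType) (K : choiceType).
Local Notation V := {malg F[K]}.

Lemma malg_ind (P : V -> Prop) :
  P 0 -> (forall c x y, P x -> P y -> P (c *: x + y)) ->
  (forall k, P << k >>) -> forall x, P x.
Proof.
move=> P0 PD PU x; rewrite [x]monalgE.
elim/big_rec: _ => // k y _ Py.
have -> : << x@_k *g k >> = x@_k *: << k >> :> V.
  by apply/malgP => l; rewrite mcoeffZ !mcoeffU mulr_natr.
exact: PD.
Qed.

Lemma bilinear0l (f : V -> V -> V) : bilinear_for *:%R *:%R f ->
  forall y, f 0 y = 0.
Proof.
by move=> [fl _] y; have := fl y (-1) 0 0; rewrite /= scaler0 addr0 scaleN1r addNr.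
Qed.

Lemma bilinear0r (f : V -> V -> V) : bilinear_for *:%R *:%R f ->
  forall x, f x 0 = 0.
Proof.
by move=> [_ fr] x; have := fr x (-1) 0 0; rewrite /= scaler0 addr0 scaleN1r addNr.
Qed.

Lemma bilinear_eq (f g : V -> V -> V) :
  bilinear_for *:%R *:%R f -> bilinear_for *:%R *:%R g ->
  (forall k l, f << k >> << l >> = g << k >> << l >>) -> forall x y, f x y = g x y.
Proof.
move=> bf bg fg x y; elim/malg_ind: x => [|c x x' IH IH'|k].
- by rewrite !bilinear0l.
- by have := bf.1 y c x x'; have := bg.1 y c x x' => /= -> ->; rewrite IH IH'.
elim/malg_ind: y => [|c y y' IH IH'|l]; last exact: fg.
- by rewrite !bilinear0r.
- by have := bf.2 << k >> c y y'; have := bg.2 << k >> c y y' => /= -> ->; rewrite IH IH'.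
Qed.

End FreeModule.

(** * Coefficients of brackets and products on basis vectors *)

Section Coefficients.
Variables (F : numFieldType) (q : F).
Local Notation V := (block_space F).
Local Notation E e a := (<< (e, a) >> : V).

Definition br_coef (e f : bool) (a b : int * int) : F :=
  match e, f with
  | false, false => b.1%:~R * (a.2%:~R + q) - a.1%:~R * (b.2%:~R + q)
  | false, true => b.1%:~R * (a.2%:~R + q) - a.1%:~R * (b.2%:~R + q / 2%:R)
  | true, false => - (a.1%:~R * (b.2%:~R + q) - b.1%:~R * (a.2%:~R + q / 2%:R))
  | true, true => 2%:R * q
  end.

Lemma block_brX e f a b :
  block_br q (E e a) (E f b) = br_coef e f a b *: E (e (+) f) (a + b).
Proof.
rewrite block_brU; case: a b => m i [n j].
case: e f => [] [] //=.
by rewrite -scaleNr /block_LG_coef /block_G [n + m]addrC [j + i]addrC.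
Qed.

Lemma block_brXl e f (a k : int * int) y :
  (block_br q (E e a) y)@_(e (+) f, a + k) = br_coef e f a k * y@_(f, k).
Proof.
elim/malg_ind: y => [|c x y IHx IHy|[f' l]].
- by rewrite block_br0r !mcoeff0 mulr0.
- by rewrite block_brDr !mcoeffD !mcoeffZ IHx IHy mulrDr mulrCA.
rewrite block_brX mcoeffZ !mcoeffU.
have -> : ((e (+) f', a + l) == (e (+) f, a + k)) = ((f', l) == (f, k)).
  by rewrite [LHS]xpair_eqE [RHS]xpair_eqE !(inj_eq (addrI _)).
by case: eqP => [[-> ->]|]; rewrite ?mulr0.
Qed.

Lemma block_brXr e f (a k : int * int) y :
  (block_br q y (E e a))@_(f (+) e, k + a) = br_coef f e k a * y@_(f, k).
Proof.
elim/malg_ind: y => [|c x y IHx IHy|[f' l]].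
- by rewrite block_br0l !mcoeff0 mulr0.
- by rewrite block_brDl !mcoeffD !mcoeffZ IHx IHy mulrDr mulrCA.
rewrite block_brX mcoeffZ !mcoeffU.
have -> : ((f' (+) e, l + a) == (f (+) e, k + a)) = ((f', l) == (f, k)).
  by rewrite [LHS]xpair_eqE [RHS]xpair_eqE !(inj_eq (addIr _)).
by case: eqP => [[-> ->]|]; rewrite ?mulr0.
Qed.

Record block_tp (mul : V -> V -> V) : Prop := BlockTP {
  btp_bilinear : bilinear_for *:%R *:%R mul;
  btp_graded : forall e f a b k,
    k.1 != e (+) f -> (mul (E e a) (E f b))@_k = 0;
  btp_comm : forall e f a b,
    mul (E e a) (E f b) = (-1) ^+ (e && f) *: mul (E f b) (E e a);
  btp_assoc : associative mul;
  btp_leibniz : forall e f g a b c,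
    2%:R *: mul (E g c) (block_br q (E e a) (E f b)) =
    block_br q (mul (E g c) (E e a)) (E f b) +
    (-1) ^+ (e && g) *: block_br q (E e a) (mul (E g c) (E f b))
}.

(** The shift [s] is measured from the second factor, not from [c + b]: for fixed [g], [c], [s] this
    is the degree [s] part of a multiplication operator, and the Leibniz identity does not mix
    different [s]. *)
Definition tp_coef (mul : V -> V -> V) g c s f b :=
  (mul (E g c) (E f b))@_(g (+) f, b + s).

Lemma tp_coef_eq mul : block_tp mul -> forall g c s e f a b,
  2%:R * (br_coef e f a b * tp_coef mul g c s (e (+) f) (a + b)) =
  br_coef (g (+) e) f (a + s) b * tp_coef mul g c s e a +
  (-1) ^+ (e && g) * (br_coef e (g (+) f) a (b + s) * tp_coef mul g c s f b).
Proof.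
move=> tp g c s e f a b.
have mulZ k x : mul (E g c) (k *: x) = k *: mul (E g c) x.
  have := (btp_bilinear tp).2 (E g c) k x 0 => /=.
  by rewrite !addr0 (bilinear0r (btp_bilinear tp)) addr0.
have := congr1 (mcoeff (g (+) (e (+) f), a + b + s)) (btp_leibniz tp e f g a b c).
rewrite block_brX mulZ mcoeffD !mcoeffZ /tp_coef => ->.
have k1 : (g (+) (e (+) f), a + b + s) = (g (+) e (+) f, a + s + b).
  by rewrite addbA addrAC.
have k2 : (g (+) (e (+) f), a + b + s) = (e (+) (g (+) f), a + (b + s)).
  by rewrite addbCA addrA.
by rewrite -block_brXr -block_brXl {1}k1 k2.
Qed.

Lemma mul_eq0 mul : block_tp mul -> forall g c f b,
  (forall s, tp_coef mul g c s f b = 0) -> mul (E g c) (E f b) = 0.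
Proof.
move=> tp g c f b h; apply/malgP => -[h' k]; rewrite mcoeff0.
have [->|ne] := eqVneq h' (g (+) f); last exact: (btp_graded tp).
by have := h (k - b); rewrite /tp_coef addrC subrK.
Qed.

(* The shift on the right is the one aiming at the same index b + s. *)
Lemma tp_coefC mul : block_tp mul -> forall g c s f b,
  tp_coef mul g c s f b = (-1) ^+ (g && f) * tp_coef mul f b (b + s - c) g c.
Proof.
move=> tp g c s f b.
have kE : c + (b + s - c) = b + s by rewrite addrC subrK.
have := congr1 (mcoeff (g (+) f, b + s)) (btp_comm tp g f c b).
by rewrite mcoeffZ /tp_coef kE [f (+) g]addbC.
Qed.

Lemma tp_coefE mul g c s f b :
  tp_coef mul g c s f b = (mul (E g c) (E f b))@_(g (+) f, b + s).
Proof. by []. Qed.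

End Coefficients.

(* Otherwise unification compares distinct basis vectors by unfolding them. *)
#[local] Opaque tp_coef.

(** * Triviality of every structure when [q] is nonzero *)

Section NonZero.
Variables (F : numFieldType) (q : F).
Hypothesis q0 : q != 0.
Local Notation om := (br_coef q false false).
Local Notation ka := (br_coef q false true).

(** Here [c] and [d] are the actions on the L's and on the G's. The second equation at [(a + b, 0)]
    and at [(a, b)] shows that [d - d 0] is additive; the first one kills this additive part, then
    every nonzero shift. *)
Lemma half_derivation_even (s : int * int) (c d : int * int -> F) :
  (forall a b, 2%:R * (om a b * c (a + b)) =
     om (a + s) b * c a + om a (b + s) * c b) ->
  (forall a b, 2%:R * c (a + b) = d a + d b) ->
  (forall a, c a = d 0 /\ d a = d 0) /\ (s != 0 -> d 0 = 0).
Proof.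
move=> LL GG.
have two0 : 2%:R != 0 :> F by rewrite Num.Theory.pnatr_eq0.
have dD a b : d (a + b) = d a + d b - d 0.
  by rewrite -GG -[a + b]addr0 GG !addr0 addrK.
have cE a : c a = (d a + d 0) / 2%:R.
  by rewrite -GG addr0; field.
(* Adding the equations at (a, 0) and at (a, 2a) leaves q a.1 (d a - d 0) = 0. *)
have d1 a : a.1 != 0 -> d a = d 0.
  case: a => m i /= m0.
  have m0' : m%:~R != 0 :> F by rewrite intr_eq0.
  have h1 := LL (m, i) 0; have h2 := LL (m, i) ((m, i) + (m, i)).
  move: h1 h2; case: (s) => u v; rewrite !cE !dD /= !intrD => h1 h2.
  apply/eqP; rewrite -subr_eq0; apply/eqP/(mulfI (mulf_neq0 q0 m0')).
  rewrite mulr0.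
  move: h1 h2 => /eqP; rewrite -subr_eq0 => /eqP h1 /eqP; rewrite -subr_eq0 => /eqP h2.
  rewrite -[RHS]addr0 -[X in _ = X + _]h1 -[X in _ = _ + X]h2.
  by field.
have dE a : d a = d 0.
  have [a1|] := eqVneq a.1 0; last exact: d1.
  have := dD a (1, 0); rewrite (d1 (1, 0)) // addrK => <-.
  by rewrite d1 //= a1.
split=> [a|s0]; first by rewrite cE dE; split=> //; field.
(* For constant coefficients the terms in [q] cancel in the equation at [(a, 0)]; [a = (1, 0)] and
   [a = (0, 1)] then isolate the coordinates of [s]. *)
have {}LL a : (s.1%:~R * a.2%:~R - a.1%:~R * s.2%:~R) * d 0 = 0.
  have := LL a 0; case: (a) => m i; case: (s) => u v.
  rewrite !cE !dE /= !intrD => /eqP; rewrite -subr_eq0 => /eqP h.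
  by rewrite -[RHS]oppr0 -[X in _ = - X]h; field.
have := LL (1, 0); have := LL (0, 1); rewrite /= !mulr1 !mul1r !mulr0 !mul0r subr0 sub0r.
move=> /eqP h1 /eqP h2; apply/eqP; apply: contraNT s0 => d0; move: h1 h2.
rewrite !mulf_eq0 (negbTE d0) !orbF oppr_eq0 !intr_eq0.
by case: (s) => u v /= /eqP -> /eqP ->.
Qed.

Variable mul : block_space F -> block_space F -> block_space F.
Hypothesis tp : block_tp q mul.
Local Notation D := (tp_coef mul).
Local Notation E e a := (<< (e, a) >> : block_space F).

Lemma mulL_eq0 c f b : mul (E false c) (E f b) = 0.
Proof.
have two0 : 2%:R != 0 :> F by rewrite Num.Theory.pnatr_eq0.
have hd c' s := @half_derivation_even s (D false c' s false) (D false c' s true).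
have {}hd c' s : (forall a, D false c' s false a = D false c' s true 0 /\
    D false c' s true a = D false c' s true 0) /\ (s != 0 -> D false c' s true 0 = 0).
  apply: hd => a b'.
    by have := tp_coef_eq tp false c' s false false a b'; rewrite /= mul1r.
  apply: (mulfI (mulf_neq0 two0 q0)).
  have := tp_coef_eq tp false c' s true true a b'; rewrite /= mul1r => h.
  by rewrite [LHS]mulrCA h -mulrDr.
suff h s : D false c s true 0 = 0.
  by apply: (mul_eq0 tp) => s; case: (f); rewrite ?((hd c s).1 b).1 ?((hd c s).1 b).2 h.
have [->|] := eqVneq s 0; last exact: (hd c s).2.
(* Exchanging the factors of indices [c] and [c + (1, 0)] turns shift 0 into shift [(1, 0)], where
   the coefficients vanish. *)
have [<- _] := (hd c 0).1 (c + (1, 0)).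
rewrite (tp_coefC tp) addr0 [c + _]addrC addrK.
by rewrite ((hd _ _).1 c).1 (hd _ _).2 ?mulr0.
Qed.

Lemma mulGL_eq0 c b : mul (E true c) (E false b) = 0.
Proof. by rewrite (btp_comm tp) mulL_eq0 scaler0. Qed.

Lemma mulG_half c s a b : 2%:R * (ka a b * D true c s true (a + b)) =
  om a (b + s) * D true c s true b.
Proof.
have := tp_coef_eq tp true c s false true a b => /= ->.
by rewrite mul1r [D _ _ _ false _]tp_coefE mulGL_eq0 mcoeff0 mulr0 add0r.
Qed.

(** Take [a = 0]: the bracket with [L_(0,0)] multiplies a vector of index [b] by [b.1 * q], so
    [2 b.1 q] is compared with [(b.1 + s.1) q]. *)
Lemma mulG_first c s b : D true c s true b != 0 -> s.1 = b.1.
Proof.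
move=> nz; have := mulG_half c s 0 b; rewrite add0r mulrA => /(mulIf nz) /=.
rewrite intrD !mulr0z !mul0r !subr0 add0r mulrA -mulrA.
move/eqP; rewrite -subr_eq0 => /eqP h.
have /eqP : (b.1%:~R - s.1%:~R) * q = 0 by rewrite -[RHS]h; ring.
by rewrite mulf_eq0 (negbTE q0) orbF subr_eq0 eqr_int => /eqP.
Qed.

(** Apply [mulG_first] also after exchanging the factors, where the shift is [b + s - c]. *)
Lemma mulG_same c s b : D true c s true b != 0 -> c.1 = b.1.
Proof.
move=> nz; have := mulG_first nz; have := nz; rewrite (tp_coefC tp) mulN1r oppr_eq0.
by move/mulG_first => /= h1 h2; lia.
Qed.

(** By [mulG_same] the coefficient vanishes at [e - (1, i)], so the bracket coefficient leading from
    there to [e = (n, j)] must be 0. It equals [n (i + q) - j - 3q/2], and [i = 0, 1] determine [n]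
    and [j]. *)
Lemma mulG_index c s e : D true c s true e != 0 ->
  e.1 = 0 /\ e.2%:~R = - (3%:R / 2%:R * q).
Proof.
move=> nz; have ce := mulG_same nz.
have z (i : int) : ka (1, i) (e - (1, i)) = 0.
  have := mulG_half c s (1, i) (e - (1, i)); rewrite [_ + (_ - _)]addrC subrK.
  have -> : D true c s true (e - (1, i)) = 0.
    by apply/eqP; apply/negPn/negP => /mulG_same h; have {}h : c.1 = e.1 - 1 := h; lia.
  move/eqP; rewrite mulr0 !mulf_eq0 (negbTE nz) orbF Num.Theory.pnatr_eq0 /=.
  by move/eqP.
have := z 0; have := z 1; case: e {z nz ce} => n j /=.
rewrite !intrD => h1 h0.
have n0 : n%:~R = 0 :> F.
  have -> : n%:~R = 0 - 0 :> F by rewrite -{1}h1 -h0; field.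
  by rewrite subr0.
split; first by apply/eqP; rewrite -(intr_eq0 F) n0.
apply/eqP; rewrite -subr_eq0 opprK -[X in _ == X]oppr0 -h0 n0.
by apply/eqP; field.
Qed.

(** By [mulG_index] both factors have the same index, and the square of an odd vector is its own
    opposite. *)
Lemma mulG_eq0 c b : mul (E true c) (E true b) = 0.
Proof.
apply: (mul_eq0 tp) => s; apply/eqP/negPn/negP => nz.
have [b1 b2] := mulG_index nz.
have := nz; rewrite (tp_coefC tp) mulN1r oppr_eq0 => /mulG_index [c1 c2].
have cb : c = b.
  case: (c) (b) b1 b2 c1 c2 => [c1 c2] [b1 b2] /= -> hb -> hc; congr (_, _).
  by apply/eqP; rewrite -(eqr_int F) hb hc.
move: nz; rewrite cb tp_coefE; have := btp_comm tp true true b b.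
rewrite /= expr1 scaleN1r => /eqP; rewrite -addr_eq0 -mulr2n => /eqP h.
have /eqP := congr1 (mcoeff (false, b + s)) h.
by rewrite mcoeffMn mcoeff0 Num.Theory.mulrn_eq0 /= => ->.
Qed.

Lemma block_tp_trivial x y : mul x y = 0.
Proof.
apply: (@bilinear_eq _ _ _ (fun _ _ => 0)) => [||[[] k] [[] l]].
- exact: btp_bilinear tp.
- by split=> ? ? ? ? /=; rewrite scaler0 addr0.
- exact: mulG_eq0.
- exact: mulGL_eq0.
- exact: mulL_eq0.
- exact: mulL_eq0.
Qed.

End NonZero.

(** * The determinant of two integer vectors, up to sign *)

Definition wedge (a b : int * int) : int := b.1 * a.2 - a.1 * b.2.

Lemma wedgeDl a b c : wedge (a + b) c = wedge a c + wedge b c.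
Proof. by rewrite /wedge /=; ring. Qed.

Lemma wedgeDr a b c : wedge a (b + c) = wedge a b + wedge a c.
Proof. by rewrite /wedge /=; ring. Qed.

Lemma wedgeNl a b : wedge (- a) b = - wedge a b.
Proof. by rewrite /wedge /=; ring. Qed.

Lemma wedgeNr a b : wedge a (- b) = - wedge a b.
Proof. by rewrite /wedge /=; ring. Qed.

Lemma wedgeC a b : wedge a b = - wedge b a.
Proof. by rewrite /wedge; ring. Qed.

Lemma wedgexx a : wedge a a = 0.
Proof. by rewrite /wedge; ring. Qed.

Lemma wedge0l a : wedge 0 a = 0.
Proof. by rewrite /wedge /=; ring. Qed.

Lemma wedge0r a : wedge a 0 = 0.
Proof. by rewrite /wedge /=; ring. Qed.

(** There are two lines to avoid, spanned by [b] and [s], and each contains at most one of the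
    pairwise independent vectors [(0, 1)], [(1, 0)], [(1, 1)]. *)
Lemma wedge_neq0 b s : b != 0 -> s != 0 ->
  exists2 a, wedge a b != 0 & wedge a s != 0.
Proof.
case: b s => b1 b2 [s1 s2]; rewrite -!pair_eqE /= !negb_and /wedge => b0 s0.
have [h|h] := boolP ((b1 != 0) && (s1 != 0)); first by exists (0, 1) => /=; lia.
have [h'|h'] := boolP ((b2 != 0) && (s2 != 0)); first by exists (1, 0) => /=; lia.
by exists (1, 1) => /=; lia.
Qed.

(** * Functional equations of half-derivations when [q = 0] *)

Section HalfDerivations.
Variable F : numFieldType.
Local Notation w a b := ((wedge a b)%:~R : F).

Lemma eq_of_scaled (k x y l r : F) : k != 0 -> l = r -> k * (x - y) = l - r -> x = y.
Proof.
move=> k0 -> /eqP; rewrite subrr mulf_eq0 (negbTE k0) /= subr_eq0.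
by move/eqP.
Qed.

Section HalfDerivation.
Variables (s : int * int) (c : int * int -> F).
Hypothesis cE : forall a b, 2%:R * (w a b * c (a + b)) =
  w (a + s) b * c a + w a (b + s) * c b.

Let wE := (wedgeDl, wedgeDr, wedgexx, wedgeNl, wedgeNr, wedge0l, wedge0r,
  rmorphD, rmorphN, rmorph0, wedgeC s).

(* The equations at (a, 2a), (a, a + s), (2a, 2a + 2s) and (a, a + 2s) give
   c (2a) = 2 c a, c (2a + s) = c (a + s), c (a + s) = c a, and
   8 c (a + s) = c a + 3 c (a + 2s). *)
Lemma half_derivation_transversal a : wedge a s != 0 -> c a = 0.
Proof.
have two a' : wedge a' s != 0 -> c (a' + a') = 2%:R * c a'.
  rewrite -(intr_eq0 F) => w0; apply: (eq_of_scaled w0 (esym (cE a' (a' + a')))).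
  by rewrite !wE /=; ring.
have step1 a' : wedge a' s != 0 -> c (a' + (a' + s)) = c (a' + s).
  rewrite -(intr_eq0 F) => w0.
  have w2 : 2%:R * w a' s != 0 by rewrite mulf_neq0 ?Num.Theory.pnatr_eq0.
  by apply: (eq_of_scaled w2 (cE a' (a' + s))); rewrite !wE /=; ring.
have step2 a' : wedge a' s != 0 -> c (a' + s) = c a'.
  move=> w0; have := cE (a' + a') ((a' + s) + (a' + s)).
  rewrite [a' + a' + _]addrACA two ?two // ?step1 //; try by rewrite !wE addr0; lia.
  move=> h; have w2 : 4%:R * w a' s != 0 by rewrite mulf_neq0 ?Num.Theory.pnatr_eq0 ?intr_eq0.
  by apply: (eq_of_scaled w2 h); rewrite !wE /=; ring.
move=> w0; have := cE a (a + s + s).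
have ws : wedge (a + s) s != 0 by rewrite !wE addr0.
have -> : a + (a + s + s) = (a + s) + (a + s) by rewrite [RHS]addrACA -[RHS]addrA -[in LHS]addrA.
(* All values now equal [c a], and the equation reads [8 c a = 4 c a] up to the factor
   [wedge a s]. *)
rewrite two // !step2 // => h.
have w2 : 4%:R * w a s != 0 by rewrite mulf_neq0 ?Num.Theory.pnatr_eq0 ?intr_eq0.
by apply: (eq_of_scaled w2 h); rewrite !wE /=; ring.
Qed.

(** A nonzero index parallel to [s] is split as [b + (a - b)] with both summands transversal to [s];
    index 0 is settled by the equation at [(b, 0)]. *)
Lemma half_derivation_shift a : s != 0 -> c a = 0.
Proof.
move=> s0; have [->|a0] := eqVneq a 0.
  have [b _ bs] := wedge_neq0 s0 s0.
  have ws : w b s != 0 by rewrite intr_eq0.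
  by apply: (eq_of_scaled ws (esym (cE b 0))); rewrite !wE /=; ring.
have [b ba bs] := wedge_neq0 a0 s0.
have [h|h] := eqVneq (wedge a s) 0; last exact: half_derivation_transversal.
have ws : 2%:R * w b a != 0 by rewrite mulf_neq0 ?Num.Theory.pnatr_eq0 ?intr_eq0.
have := cE b (a - b); rewrite [b + _]addrC subrK.
rewrite [c b]half_derivation_transversal // [c (a - b)]half_derivation_transversal //.
  by move=> h'; apply: (eq_of_scaled ws h'); rewrite !wE /=; ring.
by rewrite !wE h /= sub0r oppr_eq0.
Qed.

(** For independent [x], [y] the value at [x + y] is the mean of those at [x] and [y]. Writing
    [x = (x + y) + (- y)] gives [3 c x = c y + 2 c (- y)], and replacing [y] by [- y] yields
    [c y = c (- y)]. *)
Lemma half_derivation_const a b : s = 0 -> wedge a b != 0 -> c a = c b.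
Proof.
move=> s0 ab; have {}ab : w a b != 0 by rewrite intr_eq0.
have mean x y : w x y != 0 -> 2%:R * c (x + y) = c x + c y.
  move=> xy; apply: (eq_of_scaled xy (cE x y)); rewrite s0 !addr0; ring.
have three : 3%:R != 0 :> F by rewrite Num.Theory.pnatr_eq0.
have key x y : w x y != 0 -> 3%:R * c x = c y + 2%:R * c (- y).
  move=> xy; have h1 := mean _ _ xy.
  have := mean (x + y) (- y); rewrite addrK => h2.
  have {}h2 : 2%:R * c x = c (x + y) + c (- y).
    by apply: h2; rewrite intr_eq0 wedgeDl !wedgeNr wedgexx subr0 oppr_eq0 -(intr_eq0 F).
  have -> : 3%:R * c x = 2%:R * (2%:R * c x) - c x by ring.
  by rewrite h2 mulrDr h1; ring.
have h1 := key _ _ ab; have := key a (- b); rewrite opprK => h2.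
have {}h2 : 3%:R * c a = c (- b) + 2%:R * c b.
  by apply: h2; rewrite wedgeNr rmorphN oppr_eq0.
have h3 : c b = c (- b).
  have h : c b + 2%:R * c (- b) = c (- b) + 2%:R * c b by rewrite -h1 h2.
  by apply: (@eq_of_scaled (-1) _ _ _ _ _ h); [rewrite oppr_eq0 oner_eq0|ring].
by apply: (mulfI three); rewrite h1 -h3; ring.
Qed.

End HalfDerivation.

(** This is the equation on the G's once the bracket of [z L_a] with a G vanishes. Nonzero constants
    no longer solve it: for [s = 0] the equations at [(a, b)] and [(- a, a + b)] combine to
    [4 d b = d b]. *)
Lemma skewed_half_derivation (s : int * int) (d : int * int -> F) :
  (forall a b, 2%:R * (w a b * d (a + b)) = w a (b + s) * d b) ->
  forall b, (b != 0) || (s != 0) -> d b = 0.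
Proof.
move=> dE b bs.
have two : 2%:R != 0 :> F by rewrite Num.Theory.pnatr_eq0.
have d_trans x : wedge x s != 0 -> d x = 0.
  rewrite -(intr_eq0 F) => xs; apply: (eq_of_scaled xs (esym (dE x x))).
  by rewrite wedgeDr wedgexx add0r; ring.
have [s0|s0] := eqVneq s 0.
  have b0 : b != 0 by move: bs; rewrite s0 eqxx orbF.
  have [a ab _] := wedge_neq0 b0 b0.
  have {}ab : w a b != 0 by rewrite intr_eq0.
  have h1 := dE a b; have := dE (- a) (a + b).
  rewrite addKr s0 !addr0 wedgeNl !wedgeDr wedgexx add0r rmorphN /= => h2.
  have h3 : d (a + b) = 2%:R * d b.
    by apply: (eq_of_scaled ab h2); ring.
  move: h1; rewrite h3 s0 addr0 => h1.
  have w3 : 3%:R * w a b != 0 by rewrite mulf_neq0 ?Num.Theory.pnatr_eq0.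
  by apply: (eq_of_scaled w3 h1); ring.
have [->|b0] := eqVneq b 0.
  have [a _ as0] := wedge_neq0 s0 s0.
  have {}as0 : w a s != 0 by rewrite intr_eq0.
  apply: (eq_of_scaled as0 (esym (dE a 0))).
  by rewrite wedge0r add0r /=; ring.
have [h|] := eqVneq (wedge b s) 0; last exact: d_trans.
have [a ab as0] := wedge_neq0 b0 s0.
have := dE a (b - a); rewrite [a + _]addrC subrK (d_trans (b - a)); last first.
  by rewrite wedgeDl wedgeNl h sub0r oppr_eq0.
rewrite mulr0 wedgeDr wedgeNr wedgexx subr0 => /eqP.
by rewrite !mulf_eq0 intr_eq0 (negbTE ab) (negbTE two) /= => /eqP.
Qed.

End HalfDerivations.

(** * Vanishing of the coefficients off the centre when [q = 0] *)

Section SpecialStructures.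
Variable F : numFieldType.
Local Notation V := (block_space F).
Local Notation E e a := (<< (e, a) >> : V).

Lemma br_coef0 e f a b :
  br_coef 0 e f a b = if e && f then 0 else (wedge a b)%:~R :> F.
Proof.
case: a b => m i [n j]; rewrite /wedge rmorphB !rmorphM /=.
by case: e f => [] [] /=; rewrite ?mul0r ?mulr0 ?addr0 ?opprB.
Qed.

Variable mul : V -> V -> V.
Hypothesis tp : block_tp 0 mul.
Local Notation D := (tp_coef mul).

Lemma tp_coefLL_eq c s a b :
  2%:R * ((wedge a b)%:~R * D false c s false (a + b)) =
  (wedge (a + s) b)%:~R * D false c s false a +
  (wedge a (b + s))%:~R * D false c s false b.
Proof.
by have := tp_coef_eq tp false c s false false a b; rewrite !br_coef0 /= mul1r.
Qed.

(** For [b] other than [c], exchanging the factors turns shift 0 into the nonzero shift [b - c]; the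
    value at [c] itself equals that at an independent index. *)
Lemma tp_coefLL c s a : [|| c != 0, s != 0 | a != 0] -> D false c s false a = 0.
Proof.
have [s0|s0 _] := eqVneq s 0; last exact: (half_derivation_shift (tp_coefLL_eq c s)).
have off b : b != c -> D false c s false b = 0.
  move=> bc; rewrite (tp_coefC tp) s0 addr0 /= expr0 mul1r.
  have bc0 : b - c != 0 by rewrite subr_eq0.
  exact: (half_derivation_shift (tp_coefLL_eq b (b - c))).
have [ac|ac _] := eqVneq a c; last exact: off.
rewrite -ac in off *; rewrite /= orbb => a0; have [b ba _] := wedge_neq0 a0 a0.
have ab : b != a by apply: contraNneq ba => ->; rewrite wedgexx.
exact: etrans (esym (half_derivation_const (tp_coefLL_eq a s) s0 ba)) (off _ ab).
Qed.

Lemma tp_coefLG_off c s b : (b != 0) || (s != 0) -> D false c s true b = 0.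
Proof.
apply: skewed_half_derivation => a b'.
have := tp_coef_eq tp false c s false true a b'; rewrite !br_coef0 /= mul1r => ->.
have [h|] := boolP [|| c != 0, s != 0 | a != 0].
  by rewrite tp_coefLL // mulr0 add0r.
rewrite !negb_or !negbK => /and3P[_ /eqP -> /eqP ->].
by rewrite addr0 wedge0l mul0r add0r.
Qed.

Lemma tp_coefLG c s b : [|| c != 0, s != 0 | b != 0] -> D false c s true b = 0.
Proof.
have [bs _|/norP[/negPn/eqP -> /negPn/eqP ->]] := boolP ((b != 0) || (s != 0)).
  exact: tp_coefLG_off.
rewrite eqxx !orbF => c0; rewrite (tp_coefC tp) /= mul1r !add0r.
(* G_0 kills the commutator L_c of L_a and L_(c - a), as its products are central. *)
have GL s' a : a + s' != 0 -> D true 0 s' false a = 0.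
  move=> as0; rewrite (tp_coefC tp) tp_coefLG_off ?mulr0 //.
  by rewrite subr0 as0 orbT.
have [a ac _] := wedge_neq0 c0 c0.
(* The shift [- c] aims at index 0, the only target of G_0 L_c left open by [GL]. *)
have := tp_coef_eq tp true 0 (- c) false false a (c - a).
rewrite !br_coef0 /= mul1r [a + _]addrC subrK.
have a0 : a != 0 by apply: contraNneq ac => ->; rewrite wedge0l.
rewrite (GL _ a); last by rewrite subr_eq0; apply: contraNneq ac => ->; rewrite wedgexx.
rewrite (GL _ (c - a)); last by rewrite addrAC subrr sub0r oppr_eq0.
rewrite !mulr0 addr0 wedgeDr wedgeNr wedgexx subr0 => /eqP.
by rewrite !mulf_eq0 intr_eq0 (negbTE ac) Num.Theory.pnatr_eq0 => /eqP.
Qed.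

(** Two G's have bracket 0, so multiplication by G_c satisfies the skewed equation on the G's;
    anticommutativity settles the remaining cases. *)
Lemma tp_coefGG c s b : D true c s true b = 0.
Proof.
have GG_off c' s' b' : (b' != 0) || (s' != 0) -> D true c' s' true b' = 0.
  apply: skewed_half_derivation => x y.
  by have := tp_coef_eq tp true c' s' false true x y; rewrite !br_coef0 /= mul0r add0r mul1r.
have [/GG_off//|/norP[/negPn/eqP -> /negPn/eqP ->]] := boolP ((b != 0) || (s != 0)).
have [->|c0] := eqVneq c 0; last first.
  by rewrite (tp_coefC tp) GG_off ?mulr0 // c0.
have := tp_coefC tp true 0 0 true 0; rewrite addr0 subr0 expr1 mulN1r => /eqP.
by rewrite -addr_eq0 -mulr2n Num.Theory.mulrn_eq0 => /eqP.
Qed.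

End SpecialStructures.

Lemma scale2_eq (F : pzRingType) (V : lmodType F) (u v : V) (a a' b b' : F) :
  a = a' -> b = b' -> a *: u + b *: v = a' *: u + b' *: v.
Proof. by move=> -> ->. Qed.

(** * Products supported on the centre, and the rescaling automorphism *)

Section CentralForms.
Variable F : numFieldType.
Local Notation V := (block_space F).
Local Notation E e a := (<< (e, a) >> : V).
Local Notation L0 := (E false 0).
Local Notation G0 := (E true 0).

Definition central_form (al be : F) (x y : V) : V :=
  (al * (x@_(false, 0) * y@_(false, 0))) *: L0 +
  (be * (x@_(false, 0) * y@_(true, 0) + x@_(true, 0) * y@_(false, 0))) *: G0.

Lemma central_form_bilinear al be : bilinear_for *:%R *:%R (central_form al be).
Proof.
split=> [y c x z|x c y z] /=; rewrite /central_form !mcoeffD !mcoeffZ;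
  by move: (L0) (G0) => u v;
    rewrite scalerDr !scalerA addrACA -!scalerDl; apply: scale2_eq; ring.
Qed.

Lemma mcoeff_basis e f (a b : int * int) :
  (E e a)@_(f, b) = ((e == f) && (a == b))%:R.
Proof. by rewrite mcoeffU xpair_eqE. Qed.

Lemma central_formE al be x y xl xg yl yg :
  x@_(false, 0) = xl -> x@_(true, 0) = xg ->
  y@_(false, 0) = yl -> y@_(true, 0) = yg ->
  central_form al be x y = (al * (xl * yl)) *: L0 + (be * (xl * yg + xg * yl)) *: G0.
Proof. by move=> <- <- <- <-. Qed.

Lemma mcoeff_L0G0 a b e :
  (a *: L0 + b *: G0)@_(e, 0) = if e then b else a.
Proof.
have h f : (E f 0)@_(e, 0) = (f == e)%:R by rewrite mcoeff_basis eqxx andbT.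
have := h true; have := h false; move: (L0) (G0) => u v uE vE.
by rewrite mcoeffD !mcoeffZ uE vE; case: (e) => /=; rewrite mulr0 mulr1 ?addr0 ?add0r.
Qed.

Lemma central_formU al be g c f b :
  central_form al be (E g c) (E f b) =
  if (c == 0) && (b == 0) then
    match g, f with
    | false, false => al *: L0
    | true, true => 0
    | _, _ => be *: G0
    end
  else 0.
Proof.
have cE := central_formE al be (mcoeff_basis _ _ _ _) (mcoeff_basis _ _ _ _)
  (mcoeff_basis _ _ _ _) (mcoeff_basis _ _ _ _).
rewrite cE; move: (L0) (G0) => u v {cE}.
case: (c == 0); case: (b == 0); case: g f => [] [] /=;
  by rewrite ?(mulr0, mul0r, mulr1, addr0, add0r, scale0r).
Qed.

Lemma central_form_l al be x y :
  (central_form al be x y)@_(false, 0) = al * (x@_(false, 0) * y@_(false, 0)).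
Proof. exact: mcoeff_L0G0. Qed.

Lemma central_form_g al be x y : (central_form al be x y)@_(true, 0) =
  be * (x@_(false, 0) * y@_(true, 0) + x@_(true, 0) * y@_(false, 0)).
Proof. exact: mcoeff_L0G0. Qed.

(** The coefficients at [L0] agree; those at [G0] differ by [be * be - al * be] times
    [xl * yl * zg - xg * yl * zl]. *)
Lemma central_formA al be : be * be = al * be -> associative (central_form al be).
Proof.
move=> bb x y z.
rewrite (central_formE _ _ erefl erefl (central_form_l _ _ _ _) (central_form_g _ _ _ _)).
rewrite [RHS](central_formE _ _ (central_form_l _ _ _ _) (central_form_g _ _ _ _) erefl erefl).
apply: scale2_eq; first by ring.
move: (x@_(false, 0)) (x@_(true, 0)) (y@_(false, 0)) (y@_(true, 0)) => xl xg yl yg.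
move: (z@_(false, 0)) (z@_(true, 0)) => zl zg.
have bbm : be * be * (xl * yl * zg - xg * yl * zl) =
  al * be * (xl * yl * zg - xg * yl * zl) by rewrite bb.
by apply: (eq_of_scaled (oner_neq0 F) bbm); ring.
Qed.

Lemma br_L0l x : block_br 0 L0 x = 0.
Proof.
apply/malgP => -[e a]; have := block_brXl 0 false e 0 a x.
by rewrite add0r br_coef0 /= wedge0l mul0r mcoeff0.
Qed.

Lemma br_G0l x : block_br 0 G0 x = 0.
Proof.
apply/malgP => -[e a]; have := block_brXl 0 true (~~ e) 0 a x.
by rewrite add0r br_coef0 wedge0l if_same mul0r mcoeff0 /= negbK.
Qed.

Lemma br_L0r x : block_br 0 x L0 = 0.
Proof.
apply/malgP => -[e a]; have := block_brXr 0 false e 0 a x.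
by rewrite addr0 addbF br_coef0 wedge0r if_same mul0r mcoeff0.
Qed.

Lemma br_G0r x : block_br 0 x G0 = 0.
Proof.
apply/malgP => -[e a]; have := block_brXr 0 true (~~ e) 0 a x.
by rewrite addr0 addbT negbK br_coef0 wedge0r if_same mul0r mcoeff0.
Qed.

(** Indices with sum 0 are parallel, so their wedge vanishes. With the centrality of [L0] and [G0]
    this annihilates every term of the Leibniz identity for a central form. *)
Lemma br_coeff0 e (x y : V) : (block_br 0 x y)@_(e, 0) = 0.
Proof.
elim/malg_ind: x => [|c x x' hx hx'|[f a]].
- by rewrite block_br0l mcoeff0.
- by rewrite block_brDl mcoeffD mcoeffZ hx hx' mulr0 addr0.
have := block_brXl 0 f (f (+) e) a (- a) y.
by rewrite addKb subrr br_coef0 wedgeNr wedgexx oppr0 if_same mul0r.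
Qed.

Lemma central_form_brl al be x y z : block_br 0 (central_form al be x y) z = 0.
Proof.
by rewrite /central_form block_brDl block_brZl br_L0l br_G0l !scaler0 addr0.
Qed.

Lemma central_form_brr al be x y z : block_br 0 z (central_form al be x y) = 0.
Proof.
by rewrite /central_form block_brDr block_brZr br_L0r br_G0r !scaler0 addr0.
Qed.

Lemma central_form_br al be x y z : central_form al be z (block_br 0 x y) = 0.
Proof. by rewrite /central_form !br_coeff0 !mulr0 addr0 mulr0 !scale0r addr0. Qed.

Lemma block_hom_coeff a x k : block_hom a x -> k.1 != a -> x@_k = 0 :> F.
Proof.
by move=> hx ka; apply/mcoeff_outdom; apply: contra ka => /hx ->.
Qed.

Lemma central_form_hom al be a b x y : block_hom a x -> block_hom b y ->
  block_hom (a (+) b) (central_form al be x y).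
Proof.
move=> hx hy; have hZ c e : block_hom e (c *: E e 0).
  by have := @block_homD F e c _ _ (@block_homU F (e, 0)) (@block_hom0 F e); rewrite addr0.
have x0 : x@_(~~ a, 0) = 0 by apply: (block_hom_coeff hx); case: (a).
have y0 : y@_(~~ b, 0) = 0 by apply: (block_hom_coeff hy); case: (b).
rewrite /central_form; move: (hZ^~ false) (hZ^~ true); move: (L0) (G0) => u v hu hv.
case: a b {hx hy} x0 y0 => [] [] /= -> ->;
  rewrite ?(mul0r, mulr0, add0r, addr0, scale0r) //; exact: block_hom0.
Qed.

Lemma central_formC al be a b x y : block_hom a x -> block_hom b y ->
  central_form al be x y = (-1) ^+ (a && b) *: central_form al be y x.
Proof.
move=> hx hy; rewrite /central_form.
have [/andP[at_ bt]|_] := boolP (a && b).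
  rewrite at_ in hx; rewrite bt in hy.
  rewrite (block_hom_coeff (k := (false, 0)) hx) // (block_hom_coeff (k := (false, 0)) hy) //.
  by rewrite !(mul0r, mulr0, add0r, scale0r, scaler0).
by rewrite expr0 scale1r; apply: scale2_eq; ring.
Qed.

Definition rescale_L0 (al : F) (x : V) : V := x + ((al - 1) * x@_(false, 0)) *: L0.

Lemma rescale_L0_linear al : linear (rescale_L0 al).
Proof.
move=> c x y; rewrite /rescale_L0 mcoeffD mcoeffZ scalerDr addrACA scalerA -scalerDl.
by apply: (congr1 (fun k => c *: x + y + k *: L0)); ring.
Qed.

Lemma rescale_L0_coeff al e x : (rescale_L0 al x)@_(e, 0) =
  (if e then 1 else al) * x@_(e, 0).
Proof.
by rewrite mcoeffD mcoeffZ mcoeff_basis eqxx andbT; case: e => /=; ring.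
Qed.

Lemma rescale_L0K al : al != 0 -> cancel (rescale_L0 al) (rescale_L0 al^-1).
Proof.
move=> al0 x; rewrite {1}/rescale_L0 rescale_L0_coeff /rescale_L0 -addrA -scalerDl.
rewrite -[RHS]addr0; congr (_ + _); rewrite -[RHS](scale0r L0); congr (_ *: _).
by field.
Qed.

Lemma rescale_L0_hom al a x : block_hom a x -> block_hom a (rescale_L0 al x).
Proof.
move=> hx; rewrite /rescale_L0 addrC.
case: a hx => hx; last by apply: block_homD hx; exact: (@block_homU F (false, 0)).
by rewrite (block_hom_coeff (k := (false, 0)) hx) // mulr0 scale0r add0r.
Qed.

(** Both sides equal [block_br 0 x y]: a bracket has no coefficient at index 0, and [L0] is
    central. *)
Lemma rescale_L0_br al x y :
  rescale_L0 al (block_br 0 x y) = block_br 0 (rescale_L0 al x) (rescale_L0 al y).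
Proof.
have addL u c z : block_br 0 (u + c *: L0) z = block_br 0 u z.
  by rewrite addrC block_brDl br_L0l scaler0 add0r.
have addR u c z : block_br 0 z (u + c *: L0) = block_br 0 z u.
  by rewrite addrC block_brDr br_L0r scaler0 add0r.
by rewrite [LHS]/rescale_L0 br_coeff0 mulr0 scale0r addr0 addL addR.
Qed.

(** If [be] is nonzero then [be = al], and each mixed term contains one coordinate along [L0], whose
    rescaling absorbs the factor [al]. *)
Lemma rescale_L0_form al be x y : be * be = al * be ->
  rescale_L0 al (central_form al be x y) =
  central_form 1 (if be == 0 then 0 else 1) (rescale_L0 al x) (rescale_L0 al y).
Proof.
move=> bb; rewrite [LHS]/rescale_L0 central_form_l.
rewrite [RHS](central_formE _ _ (rescale_L0_coeff al false x)
  (rescale_L0_coeff al true x) (rescale_L0_coeff al false y) (rescale_L0_coeff al true y)).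
rewrite /central_form; move: (L0) (G0) => u v.
rewrite addrAC -scalerDl; apply: scale2_eq; first by ring.
by case: (eqVneq be 0) bb => [-> _|be0 /(mulIf be0) ->]; ring.
Qed.

End CentralForms.

(** * Every structure at [q = 0] is a central form *)

Section Classification.
Variable F : numFieldType.
Local Notation V := (block_space F).
Local Notation E e a := (<< (e, a) >> : V).
Variable mul : V -> V -> V.
Hypothesis tp : block_tp 0 mul.
Local Notation D := (tp_coef mul).

Lemma tp_coef_eq0 g c s f b :
  [|| c != 0, s != 0 | b != 0] -> D g c s f b = 0.
Proof.
case: g f => [] [] h.
- exact: (tp_coefGG tp).
(* The exchange sends [(c, s, b)] to [(b, b + s - c, c)], which is nonzero together with it. *)
- rewrite (tp_coefC tp) (tp_coefLG tp) ?mulr0 //; move: h.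
  have [->|_] := eqVneq b 0; have [->|_] := eqVneq c 0; rewrite ?orbT //=.
  by rewrite add0r subr0.
- exact: (tp_coefLG tp h).
- exact: (tp_coefLL tp h).
Qed.

Lemma mul_diag g c f b : mul (E g c) (E f b) = D g c 0 f b *: E (g (+) f) b.
Proof.
apply/malgP => -[h k]; rewrite mcoeffZ mcoeff_basis.
have [->|ne] := eqVneq h (g (+) f); last first.
  by rewrite (btp_graded tp) // mulr0.
have -> : (mul (E g c) (E f b))@_(g (+) f, k) = D g c (k - b) f b.
  by rewrite tp_coefE addrC subrK.
have [<-|bk] := eqVneq b k; first by rewrite subrr mulr1.
by rewrite mulr0 tp_coef_eq0 // subr_eq0 [k == b]eq_sym bk orbT.
Qed.

Lemma block_tp_central : exists al be : F,
  be * be = al * be /\ forall x y, mul x y = central_form al be x y.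
Proof.
pose al := D false 0 0 false 0; pose be := D false 0 0 true 0.
have mulE : forall x y, mul x y = central_form al be x y.
  apply: bilinear_eq (btp_bilinear tp) (central_form_bilinear al be) _.
  move=> [g c] [f b]; rewrite mul_diag central_formU.
  have [/andP[/eqP -> /eqP ->]|] := boolP ((c == 0) && (b == 0)); last first.
    by rewrite negb_and => h; rewrite tp_coef_eq0 ?scale0r.
  case: g f => [] [].
  - by rewrite (tp_coefGG tp) scale0r.
  - by rewrite (tp_coefC tp) addr0 subr0 mul1r.
  - by [].
  - by [].
exists al, be; split; last exact: mulE.
(* [u] and [v] stand for [L_(0,0)] and [G_(0,0)], known only through two coordinates; the relation
   between [al] and [be] is the coefficient at [G_(0,0)] of associativity on [u], [u], [v]. *)
have [u [v [ul ug vl vg]]] : exists u v : V, [/\ u@_(false, 0) = 1,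
    u@_(true, 0) = 0, v@_(false, 0) = 0 & v@_(true, 0) = 1].
  by exists (E false 0), (E true 0); split; rewrite mcoeff_basis.
have assoc x y z : central_form al be x (central_form al be y z) =
    central_form al be (central_form al be x y) z by rewrite -!mulE (btp_assoc tp).
have := etrans (esym (central_form_g al be u (central_form al be u v)))
  (etrans (congr1 (mcoeff (true, 0)) (assoc u u v)) (central_form_g al be _ v)).
rewrite (central_form_g al be u v).
rewrite (central_form_l al be u v).
rewrite (central_form_l al be u u) (central_form_g al be u u) ul ug vl vg.
by rewrite !(mul0r, mulr0, mul1r, mulr1, addr0, add0r) [be * al]mulrC.
Qed.

End Classification.

(** * Transfer to the superalgebra and conclusion *)

Section Main.
Variable R : realType.
Local Notation S := (block_superalgebra (0 : R[i])).

Lemma block_tp_of (q : R[i]) (mul : block_superalgebra q -> block_superalgebra q ->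
    block_superalgebra q) : transposed_poisson mul -> block_tp q mul.
Proof.
move=> tp; split.
- exact: tp_bilinear tp.
- move=> e f a b k ke; apply: block_hom_coeff ke.
  exact: (tp_graded tp (@block_homU _ (e, a)) (@block_homU _ (f, b))).
- move=> e f a b.
  exact: (tp_supercomm tp (@block_homU _ (e, a)) (@block_homU _ (f, b))).
- exact: tp_assoc tp.
- move=> e f g a b c.
  exact: (tp_leibniz tp (@block_homU _ (e, a)) (@block_homU _ (f, b)) (@block_homU _ (g, c))).
Qed.

Lemma central_form_tp al be : be * be = al * be ->
  @transposed_poisson _ S (@central_form _ al be).
Proof.
move=> bb; split.
- exact: central_form_bilinear.
- exact: central_form_hom.
- exact: central_formC.
- exact: central_formA.
- move=> a b c x y z _ _ _.
  change (2%:R *: central_form al be z (block_br 0 x y) =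
    block_br 0 (central_form al be z x) y +
    (-1) ^+ (a && c) *: block_br 0 x (central_form al be z y)).
  by rewrite central_form_br central_form_brl central_form_brr !scaler0 addr0.
Qed.

Lemma rescale_L0_automorphism al : al != 0 ->
  @lsa_automorphism _ S (@rescale_L0 _ al).
Proof.
move=> al0; split.
- exact: rescale_L0_linear.
- exists (rescale_L0 al^-1); first exact: rescale_L0K.
  by have := rescale_L0K (invr_neq0 al0); rewrite invrK.
- exact: rescale_L0_hom.
- exact: rescale_L0_br.
Qed.

Lemma block_form1E x y : @block_form1 R 0 x y = central_form 1 1 x y.
Proof.
move: x y; apply: bilinear_eq (bilin_ext_bilinear _) (central_form_bilinear 1 1) _.
move=> [g c] [f b]; rewrite bilin_extU central_formU !inE !xpair_eqE.
by case: (c == 0); case: (b == 0); case: g f => [] [];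
  rewrite ?eqxx ?andbF //= ?scale1r.
Qed.

Lemma block_form2E x y : @block_form2 R 0 x y = central_form 1 0 x y.
Proof.
move: x y; apply: bilinear_eq (bilin_ext_bilinear _) (central_form_bilinear 1 0) _.
move=> [g c] [f b]; rewrite bilin_extU central_formU !xpair_eqE.
by case: (c == 0); case: (b == 0); case: g f => [] [];
  rewrite ?eqxx ?andbF //= ?scale1r ?scale0r.
Qed.

Lemma central_form_nontrivial be :
  ~ @tp_trivial _ S (@central_form _ 1 be).
Proof.
move=> /(_ << (false, 0) >> << (false, 0) >>) /(congr1 (mcoeff (false, 0))).
rewrite central_form_l mcoeff0 => /eqP.
by rewrite mcoeff_basis !mul1r oner_eq0.
Qed.

End Main.

Theorem theorem3p16 (R : realType) (q : R[i]) :
  (q <> 0 ->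
     forall mul : block_superalgebra q -> block_superalgebra q ->
         block_superalgebra q,
       transposed_poisson mul -> tp_trivial mul) /\
  (q = 0 ->
     [/\ transposed_poisson (@block_form1 R q) /\ ~ tp_trivial (@block_form1 R q),
         transposed_poisson (@block_form2 R q) /\ ~ tp_trivial (@block_form2 R q) &
         forall mul : block_superalgebra q -> block_superalgebra q ->
             block_superalgebra q,
           transposed_poisson mul -> ~ tp_trivial mul ->
           tp_isomorphic mul (@block_form1 R q) \/
           tp_isomorphic mul (@block_form2 R q)]).
Proof.
split=> [/eqP q0 mul tp x y|->].
  exact: (block_tp_trivial q0 (block_tp_of tp)).
have f1 : @block_form1 R 0 = @central_form _ 1 1.
  by do 2!apply: boolp.funext => ?; apply: block_form1E.
have f2 : @block_form2 R 0 = @central_form _ 1 0.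
  by do 2!apply: boolp.funext => ?; apply: block_form2E.
rewrite f1 f2; split.
- by split; [apply: central_form_tp | apply: central_form_nontrivial].
- by split; [apply: central_form_tp; rewrite !mulr0 | apply: central_form_nontrivial].
move=> mul tp nontriv.
have [al [be [bb mulE]]] := block_tp_central (block_tp_of tp).
have al0 : al != 0.
  apply/eqP => al0; apply: nontriv => x y; rewrite mulE.
  move/eqP: bb; rewrite al0 mul0r mulf_eq0 orbb => /eqP ->.
  by rewrite /central_form !mul0r !scale0r addr0.
have iso x y : rescale_L0 al (mul x y) =
    central_form 1 (if be == 0 then 0 else 1) (rescale_L0 al x) (rescale_L0 al y).
  by rewrite mulE rescale_L0_form.
have [be0|be0] := eqVneq be 0; [right | left];
  exists (rescale_L0 al); split; try exact: rescale_L0_automorphism.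
  by move=> x y; rewrite iso be0 eqxx.
by move=> x y; rewrite iso (negbTE be0).
Qed.
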